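(* Let $L\ge2$, $2L+1\le N$, $\lambda>0$, $\beta_{0,1}=0$, and $\beta_{\ell,k}>0$ for $\ell\ge1$. Let $f,f^\epsilon\in C(\mathbb{S}^1)$, where $f^\epsilon$ is a noisy version of $f$ with $\|f-f^\epsilon\|_\infty=\|\epsilon\|_\infty$. Let $n=\lfloor L/2\rfloor$ and assume $L$ is large enough that $\|V_nf-f\|_\infty\le\|\epsilon\|_\infty$. Then $$\|\mathcal U^\beta_{\lambda,L,N}f^\epsilon-f\|_{L_2}\le\sqrt{2\pi}\,\big(2C(\lambda,\beta)+1\big)\|\epsilon\|_\infty+\frac{\sqrt\lambda}{2}\|f\|_{W^{\phi,\beta}},$$ where $$C(\lambda,\beta)=\sqrt{1+\frac1{\lambda^2}\sum_{\ell=1}^L\sum_{k=1}^2\frac1{\beta_{\ell,k}^4}}.$$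
   Context: Points $x=(\cos\theta,\sin\theta)^T$ of the unit circle $\mathbb{S}^1$ are identified with angles $\theta\in[-\pi,\pi]$ (mod $2\pi$). $C(\mathbb{S}^1)$ is the space of real continuous functions on $\mathbb{S}^1$, $\|g\|_\infty=\max_{\mathbb{S}^1}|g|$, $\langle f,g\rangle_{L_2}=\int_{-\pi}^{\pi}fg\,dx$, $\|g\|_{L_2}=\langle g,g\rangle_{L_2}^{1/2}$. Put $Y_{0,1}=1/\sqrt{2\pi}$, $Y_{\ell,1}(x)=\cos(\ell\theta)/\sqrt\pi$, $Y_{\ell,2}(x)=\sin(\ell\theta)/\sqrt\pi$ for $\ell\ge1$; $\gamma_0=0$ and $\gamma_\ell=1$ for $\ell\ge1$. The points $x_1,\dots,x_N\in\mathbb{S}^1$ are equidistant with angular step $2\pi/N$ (trapezoidal rule nodes), and $\langle v,z\rangle_N=\frac{2\pi}{N}\sum_{j=1}^Nv(x_j)z(x_j)$. $\beta_{0,1},\beta_{1,1},\beta_{1,2},\beta_{2,1},\beta_{2,2},\dots$ is a nondecreasing sequence of nonnegative reals. The operator is $$\mathcal U^\beta_{\lambda,L,N}g(x)=\sum_{\ell=0}^L\sum_{k=1}^{\gamma_\ell+1}\frac{\langle g,Y_{\ell,k}\rangle_N}{1+\lambda\beta_{\ell,k}^2}Y_{\ell,k}(x).$$ With smoothness index function $\phi(t)=t^{1/2}$, the norm is $$\|f\|_{W^{\phi,\beta}}=\Big(\sum_{\ell=0}^\infty\sum_{k=1}^{\gamma_\ell+1}\frac{|\langle f,Y_{\ell,k}\rangle_{L_2}|^2}{\phi^2(\beta_{\ell,k}^{-2})}\Big)^{1/2}=\Big(\sum_{\ell=0}^\infty\sum_{k=1}^{\gamma_\ell+1}\beta_{\ell,k}^2|\langle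 f,Y_{\ell,k}\rangle_{L_2}|^2\Big)^{1/2}$$ (assumed finite, i.e. $f\in W^{\phi,\beta}$). The de la Vallée-Poussin approximation is $$V_nf(x)=\sum_{\ell=0}^{2n-1}\sum_{k=1}^{\gamma_\ell+1}h(\ell,k)\langle f,Y_{\ell,k}\rangle_{L_2}Y_{\ell,k}(x),\qquad h(\ell,k)=\begin{cases}1,&\ell\le n,\\ 1-\frac{\ell-n}{n},&n+1\le\ell\le2n-1.\end{cases}$$ *)

(* Defs.v *)
From Stdlib Require Import Reals Lra Lia.
From Coquelicot Require Import Coquelicot.
Open Scope R_scope.

(* Stdlib reals and Coquelicot.  A function on the unit circle is represented
   as a function of the angle; a function in C(S^1) is then a continuous
   2*PI-periodic function on R. *)
Definition CS1 (g : R -> R) : Prop :=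
  (forall t, continuous g t) /\ (forall t, g (t + 2 * PI) = g t).

(* For g in C(S^1) the supremum is finite and attained. *)
Definition sup_norm (g : R -> R) : R :=
  real (Lub_Rbar (fun y => exists t, - PI <= t <= PI /\ y = Rabs (g t))).

Definition inner_L2 (u v : R -> R) : R :=
  RInt (fun t => u t * v t) (- PI) PI.

Definition norm_L2 (u : R -> R) : R := sqrt (inner_L2 u u).

Definition gam (l : nat) : nat := match l with O => 0%nat | S _ => 1%nat end.

(* Y l k is meaningful for 1 <= k <= gam l + 1. *)
Definition Y (l k : nat) (t : R) : R :=
  match l, k with
  | O, _ => 1 / sqrt (2 * PI)
  | S _, 1%nat => cos (INR l * t) / sqrt PI
  | S _, _ => sin (INR l * t) / sqrt PI
  end.

Definition sum_k (a : nat -> nat -> R) (l : nat) : R :=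
  sum_n_m (a l) 1 (gam l + 1).

(* sum_n is inclusive: l ranges over 0, ..., M. *)
Definition sum_lk (a : nat -> nat -> R) (M : nat) : R := sum_n (sum_k a) M.

(* Nodes are x 1, ..., x N; the angle of the first one is arbitrary. *)
Definition equidistant (N : nat) (x : nat -> R) : Prop :=
  forall j, (1 <= j <= N)%nat -> x j = x 1%nat + INR (j - 1) * (2 * PI / INR N).

Definition inner_N (N : nat) (x : nat -> R) (v z : R -> R) : R :=
  2 * PI / INR N * sum_n_m (fun j => v (x j) * z (x j)) 1 N.

Definition beta_nonneg (beta : nat -> nat -> R) : Prop :=
  forall l k, (1 <= k <= gam l + 1)%nat -> 0 <= beta l k.

(* Order of the sequence: (0,1), (1,1), (1,2), (2,1), (2,2), ... *)
Definition beta_nondecreasing (beta : nat -> nat -> R) : Prop :=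
  beta 0%nat 1%nat <= beta 1%nat 1%nat /\
  forall l, (1 <= l)%nat ->
    beta l 1%nat <= beta l 2%nat /\ beta l 2%nat <= beta (S l) 1%nat.

Definition U (beta : nat -> nat -> R) (lambda : R) (L N : nat) (x : nat -> R)
    (g : R -> R) (t : R) : R :=
  sum_lk (fun l k =>
    inner_N N x g (Y l k) / (1 + lambda * beta l k ^ 2) * Y l k t) L.

Definition phi (t : R) : R := sqrt t.

(* When beta l k = 0 the weight 1 / phi^2 (beta^-2) is meant to be beta^2 = 0;
   since / 0 = 0 in R, the formula below does give this (see W_termE). *)
Definition W_term (beta : nat -> nat -> R) (f : R -> R) (l k : nat) : R :=
  Rabs (inner_L2 f (Y l k)) ^ 2 / phi (/ beta l k ^ 2) ^ 2.

Lemma W_termE beta f l k :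
  W_term beta f l k = beta l k ^ 2 * Rabs (inner_L2 f (Y l k)) ^ 2.
Proof.
unfold W_term, phi, Rdiv.
rewrite pow2_sqrt.
- rewrite Rinv_inv; ring.
- destruct (Req_dec (beta l k) 0) as [H | H].
  + rewrite H, pow_i, Rinv_0 by lia; lra.
  + apply Rlt_le, Rinv_0_lt_compat, pow2_gt_0, H.
Qed.

Definition in_W (beta : nat -> nat -> R) (f : R -> R) : Prop :=
  ex_series (sum_k (W_term beta f)).

Definition W_norm (beta : nat -> nat -> R) (f : R -> R) : R :=
  sqrt (Series (sum_k (W_term beta f))).

Definition h (n l : nat) : R :=
  if (l <=? n)%nat then 1 else 1 - (INR l - INR n) / INR n.

(* de la Vallee-Poussin approximation, for 1 <= n *)
Definition V (n : nat) (f : R -> R) (t : R) : R :=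
  sum_lk (fun l k => h n l * inner_L2 f (Y l k) * Y l k t) (2 * n - 1).

Definition C_const (lambda : R) (beta : nat -> nat -> R) (L : nat) : R :=
  sqrt (1 + 1 / lambda ^ 2 *
    sum_n_m (fun l => sum_n_m (fun k => 1 / beta l k ^ 4) 1 2) 1 L).

(* Main.v *)
Require Import Defs.
From Stdlib Require Import Reals Lra Lia ZArith.
From Coquelicot Require Import Coquelicot.
Open Scope R_scope.

(** Let p = V_n f with n = floor (L / 2).  It is a trigonometric polynomial of
    degree at most 2 n - 1 <= L, and U is linear, so

      U feps - f = U (feps - p) + (U p - p) + (p - f),

    and the L2 norms of the three terms are estimated separately.

    The reason that everything fits together is that the integral over the
    circle and the trapezoidal rule with N > 2 L nodes are two instances of one
    notion: a positive linear functional that gives the exact value on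
    trigonometric polynomials of degree at most 2 L (the record [quadrature]).
    For any such functional the system Y is orthonormal up to degree L
    ([Y_orthonormal]), hence the coefficients of a polynomial of degree at most
    L are recovered ([trig_coef]), and Parseval, Bessel and Minkowski hold.

    - Since |f - feps| and |p - f| are at most e = sup_norm eps, the function
      d = feps - p is bounded by 2 e.  By Parseval for the integral, the squared
      norm of U d is the sum of the squared filtered discrete coefficients of d;
      the filter 1 / (1 + lambda beta^2) is at most 1, so Bessel for the
      trapezoidal rule bounds it by the discrete squared norm of d, at most
      2 PI (2 e)^2.  As C_const >= 1, this gives the term with 2 C_const.
    - The discrete coefficients of p are its L2 coefficients, which are at most
      those of f in absolute value.  So U p - p is f with its coefficients
      multiplied by factors of modulus at most
      lambda beta^2 / (1 + lambda beta^2) <= sqrt lambda beta / 2, and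
      Parseval gives sqrt lambda / 2 times the W norm.
    - A function bounded by e has L2 norm at most sqrt (2 PI) e; this is applied
      to p - f. *)

(** * Continuous functions *)

Definition cont (u : R -> R) : Prop := forall t, continuous u t.

Lemma cont_const c : cont (fun _ => c).
Proof. intro t; apply continuous_const. Qed.

Lemma cont_ext u v : cont u -> (forall t, v t = u t) -> cont v.
Proof. intros hu h t; apply (continuous_ext u); auto. Qed.

Lemma cont_plus u v : cont u -> cont v -> cont (fun t => u t + v t).
Proof. intros hu hv t; apply (continuous_plus u v); auto. Qed.

Lemma cont_minus u v : cont u -> cont v -> cont (fun t => u t - v t).
Proof. intros hu hv t; apply (continuous_minus u v); auto. Qed.

Lemma cont_mult u v : cont u -> cont v -> cont (fun t => u t * v t).
Proof. intros hu hv t; apply (continuous_mult u v); auto. Qed.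

Lemma cont_cos a : cont (fun t => cos (a * t)).
Proof.
intro t; apply (ex_derive_continuous (fun t => cos (a * t))); auto_derive; auto.
Qed.

Lemma cont_sin a : cont (fun t => sin (a * t)).
Proof.
intro t; apply (ex_derive_continuous (fun t => sin (a * t))); auto_derive; auto.
Qed.

Lemma cont_Y l k : cont (Y l k).
Proof.
destruct l as [|l]; [apply cont_const|].
destruct k as [|[|k]]; unfold Y, Rdiv;
  (apply cont_mult; [apply cont_sin || apply cont_cos | apply cont_const]).
Qed.

#[local] Hint Resolve cont_const cont_plus cont_minus cont_mult cont_cos
  cont_sin cont_Y : circle.

(** * Sums over the index set of the trigonometric system *)

Lemma sum_lk_O a : sum_lk a 0 = a 0%nat 1%nat.
Proof.
unfold sum_lk, sum_k; rewrite sum_O; simpl gam.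
exact (sum_n_n _ _).
Qed.

Lemma sum_lk_S a M :
  sum_lk a (S M) = sum_lk a M + (a (S M) 1%nat + a (S M) 2%nat).
Proof.
unfold sum_lk; rewrite sum_Sn; unfold plus; simpl; f_equal.
unfold sum_k; simpl gam; rewrite sum_n_Sm by lia; rewrite sum_n_n; reflexivity.
Qed.

Definition index (M l k : nat) : Prop := (l <= M)%nat /\ (1 <= k <= gam l + 1)%nat.

Lemma index_cases M l k : index (S M) l k ->
  index M l k \/ (l = S M /\ (k = 1 \/ k = 2)%nat).
Proof.
unfold index; intros [h1 h2].
destruct (Nat.eq_dec l (S M)) as [->|]; [right|left]; simpl in *; lia.
Qed.

Lemma index_S M l k : index M l k -> index (S M) l k.
Proof. unfold index; lia. Qed.

Lemma index_O : index 0 0 1.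
Proof. unfold index; simpl; lia. Qed.

Lemma index_top M k : (k = 1 \/ k = 2)%nat -> index (S M) (S M) k.
Proof. unfold index; simpl; lia. Qed.

#[local] Hint Resolve index_S index_O index_top : circle.

Lemma sum_lk_ext a b M :
  (forall l k, index M l k -> a l k = b l k) -> sum_lk a M = sum_lk b M.
Proof.
induction M as [|M IH]; intros hab; rewrite ?sum_lk_O, ?sum_lk_S.
- auto with circle.
- rewrite IH, !hab; auto with circle.
Qed.

Lemma sum_lk_le a b M :
  (forall l k, index M l k -> a l k <= b l k) -> sum_lk a M <= sum_lk b M.
Proof.
induction M as [|M IH]; intros hab; rewrite ?sum_lk_O, ?sum_lk_S.
- auto with circle.
- apply Rplus_le_compat; [|apply Rplus_le_compat]; auto with circle.
Qed.

Lemma sum_lk_plus a b M :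
  sum_lk (fun l k => a l k + b l k) M = sum_lk a M + sum_lk b M.
Proof.
induction M as [|M IH]; rewrite ?sum_lk_O, ?sum_lk_S; [|rewrite IH]; ring.
Qed.

Lemma sum_lk_scal c a M : sum_lk (fun l k => c * a l k) M = c * sum_lk a M.
Proof.
induction M as [|M IH]; rewrite ?sum_lk_O, ?sum_lk_S; [|rewrite IH]; ring.
Qed.

Definition delta (l k l' k' : nat) : R :=
  if andb (Nat.eqb l l') (Nat.eqb k k') then 1 else 0.

Lemma delta_eq l k : delta l k l k = 1.
Proof. unfold delta; rewrite !Nat.eqb_refl; reflexivity. Qed.

Lemma delta_neq l k l' k' : l <> l' \/ k <> k' -> delta l k l' k' = 0.
Proof.
intros hne; unfold delta.
destruct (Nat.eqb_spec l l'), (Nat.eqb_spec k k'); simpl; auto; lia.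
Qed.

(** An index of larger degree than all those of the sum contributes only zeros,
    which is what the induction on the degree needs for the top degree. *)
Lemma sum_lk_delta a M l k : index M l k ->
  sum_lk (fun l' k' => a l' k' * delta l' k' l k) M = a l k.
Proof.
assert (zero : forall M l k, (M < l)%nat ->
  sum_lk (fun l' k' => a l' k' * delta l' k' l k) M = 0).
{ clear; intros M l k hl.
  induction M as [|M IH]; rewrite ?sum_lk_O, ?sum_lk_S.
  - rewrite delta_neq by lia; ring.
  - rewrite IH, !delta_neq by lia; ring. }
induction M as [|M IH]; intros hlk; rewrite ?sum_lk_O, ?sum_lk_S.
- assert (l = 0 /\ k = 1)%nat as [-> ->].
  { destruct hlk as [h1 h2]; assert (l = 0%nat) as -> by lia; simpl in h2; lia. }
  rewrite delta_eq; ring.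
- destruct (index_cases _ _ _ hlk) as [h | [-> [-> | ->]]].
  + assert (l <> S M) by (destruct h; lia).
    rewrite IH, !delta_neq by auto; ring.
  + rewrite zero, delta_eq, delta_neq by lia; ring.
  + rewrite zero, delta_eq, delta_neq by lia; ring.
Qed.

Definition trig (c : nat -> nat -> R) (M : nat) (t : R) : R :=
  sum_lk (fun l k => c l k * Y l k t) M.

Lemma cont_trig c M : cont (trig c M).
Proof.
induction M as [|M IH].
- apply (cont_ext (fun t => c 0%nat 1%nat * Y 0 1 t)); auto with circle.
  intro t; unfold trig; rewrite sum_lk_O; reflexivity.
- apply (cont_ext (fun t => trig c M t +
    (c (S M) 1%nat * Y (S M) 1 t + c (S M) 2%nat * Y (S M) 2 t)));
    auto 8 with circle.
  intro t; unfold trig; rewrite sum_lk_S; reflexivity.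
Qed.

#[local] Hint Resolve cont_trig : circle.

(** * Positive functionals that integrate trigonometric polynomials exactly *)

(** The linearity field takes the combination as a function w that agrees with
    a * u + v pointwise, so that it also expresses that I depends only on the
    values of its argument.  Exactness is stated on the functions cos (m t) and
    sin (m t), which span the trigonometric polynomials of degree at most D. *)
Record quadrature (D : nat) (I : (R -> R) -> R) : Prop := {
  quad_lin : forall a u v w, cont u -> cont v ->
    (forall t, w t = a * u t + v t) -> I w = a * I u + I v;
  quad_pos : forall u, cont u -> (forall t, 0 <= u t) -> 0 <= I u;
  quad_one : I (fun _ => 1) = 2 * PI;
  quad_cos : forall m, (1 <= m <= D)%nat -> I (fun t => cos (INR m * t)) = 0;
  quad_sin : forall m, (1 <= m <= D)%nat -> I (fun t => sin (INR m * t)) = 0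
}.

Section Quadrature.

Variables (D : nat) (I : (R -> R) -> R).
Hypothesis HI : quadrature D I.

Lemma quad_zero w : (forall t, w t = 0) -> I w = 0.
Proof.
intros hw.
assert (E : I (fun _ => 0) = 0).
{ generalize (quad_lin _ _ HI 1 (fun _ => 0) (fun _ => 0) (fun _ => 0)).
  intros E; specialize (E (cont_const 0) (cont_const 0)).
  lapply E; [lra | intro; ring]. }
rewrite (quad_lin _ _ HI 1 (fun _ => 0) (fun _ => 0)); auto with circle.
- lra.
- intro t; rewrite hw; ring.
Qed.

Lemma quad_scal a u w : cont u -> (forall t, w t = a * u t) -> I w = a * I u.
Proof.
intros hu hw.
rewrite (quad_lin _ _ HI a u (fun _ => 0)); auto with circle.
- rewrite (quad_zero (fun _ => 0)) by auto; ring.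
- intro t; rewrite hw; ring.
Qed.

Lemma quad_ext u w : cont u -> (forall t, w t = u t) -> I w = I u.
Proof.
intros hu hw; rewrite (quad_scal 1 u); auto; [ring|intro t; rewrite hw; ring].
Qed.

Lemma quad_plus u v w : cont u -> cont v ->
  (forall t, w t = u t + v t) -> I w = I u + I v.
Proof.
intros hu hv hw; rewrite (quad_lin _ _ HI 1 u v); auto; [ring|].
intro t; rewrite hw; ring.
Qed.

(** The product formulas for sines and cosines produce the frequency l - l',
    which may be negative; integer frequencies avoid a case split there. *)
Lemma quad_cosZ z : (Z.abs z <= Z.of_nat D)%Z -> z <> 0%Z ->
  I (fun t => cos (IZR z * t)) = 0.
Proof.
intros hz hz0.
rewrite (quad_ext (fun t => cos (INR (Z.abs_nat z) * t))); auto with circle.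
- apply (quad_cos _ _ HI); lia.
- intro t; rewrite INR_IZR_INZ, Zabs2Nat.id_abs, abs_IZR.
  unfold Rabs; destruct (Rcase_abs (IZR z)); auto.
  rewrite <- cos_neg; f_equal; ring.
Qed.

Lemma quad_sinZ z : (Z.abs z <= Z.of_nat D)%Z -> I (fun t => sin (IZR z * t)) = 0.
Proof.
intros hz.
destruct (Z.eq_dec z 0) as [-> | hz0].
{ apply quad_zero; intro t; rewrite Rmult_0_l; apply sin_0. }
assert (E : I (fun t => sin (INR (Z.abs_nat z) * t)) = 0)
  by (apply (quad_sin _ _ HI); lia).
destruct (Z.le_gt_cases 0 z) as [h | h].
- rewrite <- E; apply quad_ext; auto with circle.
  intro t; rewrite INR_IZR_INZ, Zabs2Nat.id_abs, Z.abs_eq; auto.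
- rewrite (quad_scal (-1) (fun t => sin (INR (Z.abs_nat z) * t))), E;
    auto with circle; [ring|].
  intro t; rewrite INR_IZR_INZ, Zabs2Nat.id_abs, Z.abs_neq, opp_IZR by lia.
  rewrite <- Ropp_mult_distr_l, sin_neg; ring.
Qed.

(** The right-hand side of the product formula of two cosines for s = 1, and of
    two sines for s = -1. *)
Lemma quad_cos_comb a b s : (Z.abs (a - b) <= Z.of_nat D)%Z ->
  (Z.abs (a + b) <= Z.of_nat D)%Z -> (a + b <> 0)%Z ->
  I (fun t => / 2 * cos (IZR (a - b) * t) + s * / 2 * cos (IZR (a + b) * t))
    = if Z.eqb a b then PI else 0.
Proof.
intros h1 h2 h3.
rewrite (quad_lin _ _ HI (/ 2) (fun t => cos (IZR (a - b) * t))
  (fun t => s * / 2 * cos (IZR (a + b) * t))); auto with circle.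
rewrite (quad_scal (s * / 2) (fun t => cos (IZR (a + b) * t))
  (fun t => s * / 2 * cos (IZR (a + b) * t))), (quad_cosZ (a + b));
  auto with circle.
destruct (Z.eqb_spec a b) as [-> | hab].
- rewrite (quad_ext (fun _ => 1)), (quad_one _ _ HI); auto with circle; [field|].
  intro t; rewrite Z.sub_diag, Rmult_0_l; apply cos_0.
- rewrite quad_cosZ by lia; ring.
Qed.

Lemma quad_sin_comb a b r s : (Z.abs a <= Z.of_nat D)%Z ->
  (Z.abs b <= Z.of_nat D)%Z ->
  I (fun t => r * sin (IZR a * t) + s * sin (IZR b * t)) = 0.
Proof.
intros ha hb.
rewrite (quad_lin _ _ HI r (fun t => sin (IZR a * t))
  (fun t => s * sin (IZR b * t))); auto with circle.
rewrite (quad_scal s (fun t => sin (IZR b * t)) (fun t => s * sin (IZR b * t)));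
  auto with circle.
rewrite !quad_sinZ by auto; ring.
Qed.

Lemma Y_O k t : Y 0 k t = 1 / sqrt (2 * PI).
Proof. reflexivity. Qed.

Lemma quad_Y0_Y l k : (1 <= l <= D)%nat -> (k = 1 \/ k = 2)%nat ->
  I (fun t => Y 0 1 t * Y l k t) = 0.
Proof.
intros hl hk; destruct l as [|l]; [lia|].
destruct hk as [-> | ->].
- rewrite (quad_scal (1 / sqrt (2 * PI) / sqrt PI)
    (fun t => cos (INR (S l) * t))), (quad_cos _ _ HI); auto with circle.
  + ring.
  + intro t; unfold Y, Rdiv; ring.
- rewrite (quad_scal (1 / sqrt (2 * PI) / sqrt PI)
    (fun t => sin (INR (S l) * t))), (quad_sin _ _ HI); auto with circle.
  + ring.
  + intro t; unfold Y, Rdiv; ring.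
Qed.

Lemma INR_minus_IZR a b : INR a - INR b = IZR (Z.of_nat a - Z.of_nat b).
Proof. rewrite minus_IZR, !INR_IZR_INZ; reflexivity. Qed.

Lemma INR_plus_IZR a b : INR a + INR b = IZR (Z.of_nat a + Z.of_nat b).
Proof. rewrite plus_IZR, !INR_IZR_INZ; reflexivity. Qed.

(** A product of two elements of degree at most M is a trigonometric polynomial
    of degree at most 2 M, by the product formulas; only the frequency
    l - l' = 0 survives. *)
Lemma Y_orthonormal M l k l' k' : (2 * M <= D)%nat ->
  index M l k -> index M l' k' ->
  I (fun t => Y l k t * Y l' k' t) = delta l k l' k'.
Proof.
intros hM [hl hk] [hl' hk'].
assert (hpi := PI_RGT_0).
assert (hs : sqrt PI * sqrt PI = PI) by (apply sqrt_sqrt; lra).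
assert (hs0 : sqrt PI <> 0) by (intro E; rewrite E in hs; lra).
assert (h2s : sqrt (2 * PI) * sqrt (2 * PI) = 2 * PI) by (apply sqrt_sqrt; lra).
assert (h2s0 : sqrt (2 * PI) <> 0) by (intro E; rewrite E in h2s; lra).
destruct l as [|l], l' as [|l']; simpl gam in hk, hk'.
- assert (k = 1%nat) as -> by lia; assert (k' = 1%nat) as -> by lia.
  rewrite (quad_scal (/ (2 * PI)) (fun _ => 1)), (quad_one _ _ HI); auto with circle.
  + rewrite delta_eq; field; lra.
  + intro t; rewrite !Y_O.
    replace (/ (2 * PI)) with (/ sqrt (2 * PI) * / sqrt (2 * PI))
      by (rewrite <- Rinv_mult, h2s; reflexivity).
    field; auto.
- assert (k = 1%nat) as -> by lia.
  rewrite quad_Y0_Y, delta_neq by lia; reflexivity.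
- assert (k' = 1%nat) as -> by lia.
  rewrite (quad_ext (fun t => Y 0 1 t * Y (S l) k t)); auto with circle;
    [|intro t; ring].
  rewrite quad_Y0_Y, delta_neq by lia; reflexivity.
- assert (hkc : (k = 1 \/ k = 2)%nat) by lia.
  assert (hkc' : (k' = 1 \/ k' = 2)%nat) by lia.
  destruct hkc as [-> | ->], hkc' as [-> | ->].
  + rewrite (quad_scal (/ PI) (fun t =>
      / 2 * cos (IZR (Z.of_nat (S l) - Z.of_nat (S l')) * t) +
      1 * / 2 * cos (IZR (Z.of_nat (S l) + Z.of_nat (S l')) * t)));
      auto with circle.
    * rewrite quad_cos_comb by lia.
      destruct (Z.eqb_spec (Z.of_nat (S l)) (Z.of_nat (S l'))) as [E | E].
      -- assert (l = l') as -> by lia; rewrite delta_eq; field; lra.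
      -- rewrite delta_neq by lia; ring.
    * intro t; rewrite <- INR_minus_IZR, <- INR_plus_IZR.
      rewrite Rmult_minus_distr_r, Rmult_plus_distr_r, cos_minus, cos_plus.
      rewrite <- hs; unfold Y; field; auto.
  + rewrite (quad_scal (/ PI) (fun t =>
      / 2 * sin (IZR (Z.of_nat (S l) + Z.of_nat (S l')) * t) +
      - / 2 * sin (IZR (Z.of_nat (S l) - Z.of_nat (S l')) * t)));
      auto with circle.
    * rewrite quad_sin_comb, delta_neq by lia; ring.
    * intro t; rewrite <- INR_minus_IZR, <- INR_plus_IZR.
      rewrite Rmult_minus_distr_r, Rmult_plus_distr_r, sin_minus, sin_plus.
      rewrite <- hs; unfold Y; field; auto.
  + rewrite (quad_scal (/ PI) (fun t =>
      / 2 * sin (IZR (Z.of_nat (S l) + Z.of_nat (S l')) * t) +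
      / 2 * sin (IZR (Z.of_nat (S l) - Z.of_nat (S l')) * t)));
      auto with circle.
    * rewrite quad_sin_comb, delta_neq by lia; ring.
    * intro t; rewrite <- INR_minus_IZR, <- INR_plus_IZR.
      rewrite Rmult_minus_distr_r, Rmult_plus_distr_r, sin_minus, sin_plus.
      rewrite <- hs; unfold Y; field; auto.
  + rewrite (quad_scal (/ PI) (fun t =>
      / 2 * cos (IZR (Z.of_nat (S l) - Z.of_nat (S l')) * t) +
      (-1) * / 2 * cos (IZR (Z.of_nat (S l) + Z.of_nat (S l')) * t)));
      auto with circle.
    * rewrite quad_cos_comb by lia.
      destruct (Z.eqb_spec (Z.of_nat (S l)) (Z.of_nat (S l'))) as [E | E].
      -- assert (l = l') as -> by lia; rewrite delta_eq; field; lra.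
      -- rewrite delta_neq by lia; ring.
    * intro t; rewrite <- INR_minus_IZR, <- INR_plus_IZR.
      rewrite Rmult_minus_distr_r, Rmult_plus_distr_r, cos_minus, cos_plus.
      rewrite <- hs; unfold Y; field; auto.
Qed.

Lemma quad_trig c M w : cont w ->
  I (fun t => trig c M t * w t) =
  sum_lk (fun l k => c l k * I (fun t => Y l k t * w t)) M.
Proof.
intros hw.
induction M as [|M IH].
- rewrite sum_lk_O; apply quad_scal; auto with circle.
  intro t; unfold trig; rewrite sum_lk_O; ring.
- rewrite sum_lk_S, <- IH.
  rewrite (quad_plus (fun t => trig c M t * w t) (fun t =>
    c (S M) 1%nat * (Y (S M) 1 t * w t) + c (S M) 2%nat * (Y (S M) 2 t * w t)));
    auto 6 with circle.
  + f_equal.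
    rewrite (quad_lin _ _ HI (c (S M) 1%nat) (fun t => Y (S M) 1 t * w t)
      (fun t => c (S M) 2%nat * (Y (S M) 2 t * w t))); auto with circle.
    f_equal; apply quad_scal; auto with circle.
  + intro t; unfold trig; rewrite sum_lk_S; ring.
Qed.

Lemma trig_coef c M l k : (2 * M <= D)%nat -> index M l k ->
  I (fun t => trig c M t * Y l k t) = c l k.
Proof.
intros hM hlk; rewrite quad_trig by auto with circle.
rewrite <- (sum_lk_delta c M l k hlk).
apply sum_lk_ext; intros l' k' h'.
rewrite (Y_orthonormal M); auto.
Qed.

Lemma parseval c M : (2 * M <= D)%nat ->
  I (fun t => trig c M t * trig c M t) = sum_lk (fun l k => c l k ^ 2) M.
Proof.
intros hM; rewrite quad_trig by auto with circle.
apply sum_lk_ext; intros l k h'.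
rewrite (quad_ext (fun t => trig c M t * Y l k t)), trig_coef; auto with circle.
- ring.
- intro t; ring.
Qed.

Lemma quad_square_comb a b u v : cont u -> cont v ->
  I (fun t => (a * u t + b * v t) * (a * u t + b * v t)) =
  a ^ 2 * I (fun t => u t * u t) + 2 * a * b * I (fun t => u t * v t)
    + b ^ 2 * I (fun t => v t * v t).
Proof.
intros hu hv.
rewrite (quad_lin _ _ HI (a ^ 2) (fun t => u t * u t)
  (fun t => (2 * a * b) * (u t * v t) + b ^ 2 * (v t * v t))); auto 6 with circle;
  [|intro t; ring].
rewrite Rplus_assoc; f_equal.
rewrite (quad_lin _ _ HI (2 * a * b) (fun t => u t * v t)
  (fun t => b ^ 2 * (v t * v t))); auto with circle.
f_equal; apply quad_scal; auto with circle.
Qed.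

Lemma quad_square_pos u : cont u -> 0 <= I (fun t => u t * u t).
Proof.
intros hu; apply (quad_pos _ _ HI); auto with circle; intro t; nra.
Qed.

Lemma quad_square_le u M : cont u -> (forall t, Rabs (u t) <= M) ->
  I (fun t => u t * u t) <= 2 * PI * M ^ 2.
Proof.
intros hu hM.
assert (h : 0 <= I (fun t => M ^ 2 * 1 + -1 * (u t * u t))).
{ apply (quad_pos _ _ HI); auto with circle.
  intro t; specialize (hM t); apply Rabs_le_between in hM; nra. }
rewrite (quad_lin _ _ HI (M ^ 2) (fun _ => 1) (fun t => -1 * (u t * u t))) in h;
  auto with circle.
rewrite (quad_scal (-1) (fun t => u t * u t) (fun t => -1 * (u t * u t))) in h;
  auto with circle.
rewrite (quad_one _ _ HI) in h; lra.
Qed.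

(** Expand the square of g minus its projection. *)
Lemma bessel g M : (2 * M <= D)%nat -> cont g ->
  sum_lk (fun l k => I (fun t => g t * Y l k t) ^ 2) M <= I (fun t => g t * g t).
Proof.
intros hM hg.
set (c := fun l k => I (fun t => g t * Y l k t)).
assert (h : 0 <= I (fun t => (1 * g t + -1 * trig c M t)
    * (1 * g t + -1 * trig c M t)))
  by (apply (quad_square_pos (fun t => 1 * g t + -1 * trig c M t));
      auto with circle).
rewrite (quad_square_comb 1 (-1) g (trig c M)), parseval in h; auto with circle.
assert (E : I (fun t => g t * trig c M t) = sum_lk (fun l k => c l k ^ 2) M).
{ rewrite (quad_ext (fun t => trig c M t * g t)); auto with circle;
    [|intro t; ring].
  rewrite quad_trig by auto.
  apply sum_lk_ext; intros l k _.
  rewrite (quad_ext (fun t => g t * Y l k t)); auto with circle; [|intro t; ring].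
  fold (c l k); ring. }
rewrite E in h; unfold c in h; lra.
Qed.

(** The Cauchy-Schwarz step needs positive norms to divide by, so it is done with
    a > sqrt A and c > sqrt C, which then tend to the norms. *)
Lemma minkowski u v : cont u -> cont v ->
  sqrt (I (fun t => (u t + v t) * (u t + v t))) <=
  sqrt (I (fun t => u t * u t)) + sqrt (I (fun t => v t * v t)).
Proof.
intros hu hv.
assert (hA := quad_square_pos u hu); assert (hC := quad_square_pos v hv).
set (A := I (fun t => u t * u t)) in *; set (C := I (fun t => v t * v t)) in *.
set (B := I (fun t => u t * v t)).
assert (E : I (fun t => (u t + v t) * (u t + v t)) = A + 2 * B + C).
{ rewrite (quad_ext (fun t => (1 * u t + 1 * v t) * (1 * u t + 1 * v t))).
  - rewrite quad_square_comb by auto; unfold A, B, C; ring.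
  - auto 7 with circle.
  - intro t; ring. }
rewrite E; apply le_epsilon; intros eps heps.
assert (ha := sqrt_pos A); assert (hc := sqrt_pos C).
assert (hA2 := sqrt_sqrt A hA); assert (hC2 := sqrt_sqrt C hC).
set (a := sqrt A + eps / 2); set (c := sqrt C + eps / 2).
assert (a0 : 0 < a) by (unfold a; lra); assert (c0 : 0 < c) by (unfold c; lra).
assert (hAa : A <= a ^ 2) by (unfold a; nra).
assert (hCc : C <= c ^ 2) by (unfold c; nra).
assert (hB : B <= a * c).
{ assert (h : 0 <= I (fun t => (c * u t + - a * v t) * (c * u t + - a * v t)))
    by (apply (quad_square_pos (fun t => c * u t + - a * v t)); auto with circle).
  rewrite quad_square_comb in h by auto.
  fold A B C in h.
  assert (c ^ 2 * A <= c ^ 2 * a ^ 2) by (apply Rmult_le_compat_l; nra).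
  assert (a ^ 2 * C <= a ^ 2 * c ^ 2) by (apply Rmult_le_compat_l; nra).
  assert (0 < a * c) by nra.
  apply Rmult_le_reg_l with (a * c); nra. }
replace (sqrt A + sqrt C + eps) with (a + c) by (unfold a, c; lra).
rewrite <- (sqrt_pow2 (a + c)) by lra.
apply sqrt_le_1_alt; nra.
Qed.

End Quadrature.

(** * The integral and the trapezoidal rule *)

Lemma integral_quadrature D : quadrature D (fun u => RInt u (- PI) PI).
Proof.
assert (hpi := PI_RGT_0).
assert (ex : forall u, cont u -> ex_RInt u (- PI) PI)
  by (intros u hu; apply (ex_RInt_continuous (V := R_CompleteNormedModule));
      intros; apply hu).
split.
- intros a u v w hu hv hw.
  apply is_RInt_unique.
  apply (is_RInt_ext (fun t => plus (scal a (u t)) (v t)));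
    [intros; symmetry; apply hw|].
  apply (is_RInt_plus (fun t => scal a (u t)) v);
    [apply (is_RInt_scal u)|]; apply (RInt_correct (V := R_CompleteNormedModule));
    auto.
- intros u hu h; apply RInt_ge_0; auto; lra.
- rewrite RInt_const; unfold scal; simpl; unfold mult; simpl; ring.
- intros m hm.
  assert (m0 : INR m <> 0) by (apply not_0_INR; lia).
  apply is_RInt_unique.
  replace 0 with (minus (sin (INR m * PI) / INR m) (sin (INR m * - PI) / INR m)).
  + apply (is_RInt_derive (fun t => sin (INR m * t) / INR m)).
    * intros t _; auto_derive; auto; field; auto.
    * intros t _; apply cont_cos.
  + rewrite <- Ropp_mult_distr_r, sin_neg.
    assert (E : sin (INR m * PI) = 0)
      by (rewrite INR_IZR_INZ; apply sin_eq_0_1; eexists; reflexivity).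
    rewrite E; unfold minus, plus, opp; simpl; field; auto.
- intros m hm.
  assert (m0 : INR m <> 0) by (apply not_0_INR; lia).
  apply is_RInt_unique.
  replace 0 with (minus (- cos (INR m * PI) / INR m) (- cos (INR m * - PI) / INR m)).
  + apply (is_RInt_derive (fun t => - cos (INR m * t) / INR m)).
    * intros t _; auto_derive; auto; field; auto.
    * intros t _; apply cont_sin.
  + rewrite <- Ropp_mult_distr_r, cos_neg.
    unfold minus, plus, opp; simpl; field; auto.
Qed.

Definition trapezoid (N : nat) (x : nat -> R) (u : R -> R) : R :=
  2 * PI / INR N * sum_n_m (fun j => u (x j)) 1 N.

(** Each term telescopes: 2 sin (d/2) cos y = sin (y + d/2) - sin (y - d/2). *)
Lemma sum_cos_progression theta d n :
  2 * sin (d / 2) * sum_n_m (fun j => cos (theta + INR (j - 1) * d)) 1 n =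
  sin (theta + (INR n - 1 / 2) * d) - sin (theta - d / 2).
Proof.
induction n as [|n IH].
- rewrite sum_n_m_zero by lia; unfold zero; simpl.
  replace (theta + (0 - 1 / 2) * d) with (theta - d / 2) by field; ring.
- rewrite sum_n_Sm by lia; unfold plus; simpl plus; rewrite Rmult_plus_distr_l, IH.
  replace (S n - 1)%nat with n by lia; rewrite S_INR.
  replace (theta + (INR n + 1 - 1 / 2) * d) with (theta + INR n * d + d / 2) by field.
  replace (theta + (INR n - 1 / 2) * d) with (theta + INR n * d - d / 2) by field.
  rewrite sin_plus, (sin_minus (theta + INR n * d)); ring.
Qed.

(** The two boundary terms of the telescoping sum differ by m full turns, while
    the factor sin (PI m / N) is positive because 0 < m < N.  The phase theta is
    free so that sines are covered too, by a shift of PI / 2. *)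
Lemma sum_cos_nodes N m theta : (1 <= m < N)%nat ->
  sum_n_m (fun j => cos (theta + INR (j - 1) * (INR m * (2 * PI / INR N)))) 1 N = 0.
Proof.
intros hm.
assert (hpi := PI_RGT_0).
assert (N0 : 0 < INR N) by (apply lt_0_INR; lia).
assert (m0 : 0 < INR m) by (apply lt_0_INR; lia).
assert (mN : INR m < INR N) by (apply lt_INR; lia).
assert (hs : 0 < sin (INR m * (2 * PI / INR N) / 2)).
{ replace (INR m * (2 * PI / INR N) / 2) with (INR m / INR N * PI) by (field; lra).
  assert (0 < INR m / INR N) by (apply Rdiv_lt_0_compat; lra).
  assert (INR m / INR N < 1) by (apply -> Rdiv_lt_1; lra).
  apply sin_gt_0; nra. }
assert (E := sum_cos_progression theta (INR m * (2 * PI / INR N)) N).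
replace (theta + (INR N - 1 / 2) * (INR m * (2 * PI / INR N))) with
  (theta - INR m * (2 * PI / INR N) / 2 + 2 * INR m * PI) in E by (field; lra).
rewrite sin_period in E.
apply Rmult_eq_reg_l with (2 * sin (INR m * (2 * PI / INR N) / 2)); lra.
Qed.

Lemma trapezoid_quadrature D N x : (D < N)%nat -> equidistant N x ->
  quadrature D (trapezoid N x).
Proof.
intros hN hx.
assert (hpi := PI_RGT_0).
assert (N0 : 0 < INR N) by (apply lt_0_INR; lia).
assert (q0 : 0 <= 2 * PI / INR N) by (apply Rlt_le, Rdiv_lt_0_compat; lra).
unfold trapezoid; split.
- intros a u v w _ _ hw.
  rewrite (sum_n_m_ext _ (fun j => a * u (x j) + v (x j))) by (intro; apply hw).
  assert (E1 : sum_n_m (fun j => a * u (x j) + v (x j)) 1 N =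
    sum_n_m (fun j => a * u (x j)) 1 N + sum_n_m (fun j => v (x j)) 1 N)
    by exact (sum_n_m_plus (G := R_AbelianMonoid) _ _ 1 N).
  assert (E2 : sum_n_m (fun j => a * u (x j)) 1 N =
    a * sum_n_m (fun j => u (x j)) 1 N)
    by exact (sum_n_m_mult_l (K := R_Ring) a _ 1 N).
  rewrite E1, E2; ring.
- intros u _ hu; apply Rmult_le_pos; auto.
  assert (h : sum_n_m (fun _ => 0) 1 N <= sum_n_m (fun j => u (x j)) 1 N)
    by (apply sum_n_m_le; auto).
  rewrite sum_n_m_const, Rmult_0_r in h; exact h.
- rewrite sum_n_m_const.
  replace (S N - 1)%nat with N by lia; field; lra.
- intros m hm.
  rewrite (sum_n_m_ext_loc _ (fun j =>
    cos (INR m * x 1%nat + INR (j - 1) * (INR m * (2 * PI / INR N))))).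
  + rewrite sum_cos_nodes by lia; ring.
  + intros j hj; rewrite (hx j) by lia; f_equal; ring.
- intros m hm.
  rewrite (sum_n_m_ext_loc _ (fun j => cos (INR m * x 1%nat - PI / 2
    + INR (j - 1) * (INR m * (2 * PI / INR N))))).
  + rewrite sum_cos_nodes by lia; ring.
  + intros j hj; rewrite (hx j) by lia.
    rewrite <- cos_shift, <- cos_neg; f_equal; ring.
Qed.

(** * The supremum norm *)

Lemma periodic_reduce g : CS1 g ->
  forall t, exists s, - PI <= s <= PI /\ g t = g s.
Proof.
intros [_ hp] t.
assert (hpi := PI_RGT_0).
assert (hn : forall (n : nat) s, g (s + INR n * (2 * PI)) = g s).
{ induction n as [|n IH]; intro s.
  - f_equal; simpl; ring.
  - rewrite <- (IH s), <- (hp (s + INR n * (2 * PI))); f_equal; rewrite S_INR; ring. }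
assert (hz : forall (z : Z) s, g (s + IZR z * (2 * PI)) = g s).
{ intros z s; destruct (Z.le_gt_cases 0 z) as [h | h].
  - rewrite <- (hn (Z.to_nat z) s), INR_IZR_INZ, Z2Nat.id; auto.
  - rewrite <- (hn (Z.to_nat (- z)) (s + IZR z * (2 * PI))), INR_IZR_INZ, Z2Nat.id by lia.
    f_equal; rewrite opp_IZR; ring. }
(* Shift by the integer part of q, which is up q - 1. *)
set (q := (t + PI) / (2 * PI)).
assert (hq : q * (2 * PI) = t + PI) by (unfold q; field; lra).
exists (t + IZR (- (up q - 1)) * (2 * PI)); split; [|rewrite hz; reflexivity].
destruct (archimed q) as [h1 h2].
rewrite opp_IZR, minus_IZR; nra.
Qed.

(** The supremum is taken over one period: periodicity carries the bound to
    every angle, in particular to the nodes, and the maximum over the compact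
    interval makes the least upper bound finite. *)
Lemma sup_norm_ge g : CS1 g -> forall t, Rabs (g t) <= sup_norm g.
Proof.
intros hg t.
destruct (periodic_reduce g hg t) as [s [hs ->]].
assert (hpi := PI_RGT_0).
destruct (continuity_ab_maj (fun t => Rabs (g t)) (- PI) PI) as [m [hm _]]; [lra| |].
{ intros c _; apply continuity_pt_filterlim.
  apply (continuous_comp g Rabs); [apply hg | apply continuous_Rabs]. }
unfold sup_norm.
set (E := fun y => exists t, - PI <= t <= PI /\ y = Rabs (g t)).
destruct (Lub_Rbar_correct E) as [hub hleast].
assert (h1 : Rbar_le (Rabs (g s)) (Lub_Rbar E)) by (apply hub; exists s; auto).
assert (h2 : Rbar_le (Lub_Rbar E) (Rabs (g m))).
{ apply hleast; intros y [r [hr ->]]; apply hm; auto. }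
destruct (Lub_Rbar E); simpl in *; auto; contradiction.
Qed.

Lemma CS1_minus u v : CS1 u -> CS1 v -> CS1 (fun t => u t - v t).
Proof.
intros [hu pu] [hv pv]; split.
- apply (cont_minus u v hu hv).
- intro t; rewrite pu, pv; reflexivity.
Qed.

Lemma CS1_trig c M : CS1 (trig c M).
Proof.
split; [apply cont_trig|].
intro t; apply sum_lk_ext; intros l k _; f_equal.
destruct l as [|l]; [reflexivity|].
assert (E : INR (S l) * (t + 2 * PI) = INR (S l) * t + 2 * INR (S l) * PI) by ring.
unfold Y; rewrite E, sin_period, cos_period; reflexivity.
Qed.

(** * The estimate *)

Lemma partial_sum_le_W_norm beta f M : in_W beta f ->
  sum_lk (W_term beta f) M <= W_norm beta f ^ 2.
Proof.
intros hW.
assert (term_pos : forall l k, 0 <= W_term beta f l k).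
{ intros l k; rewrite W_termE; apply Rmult_le_pos; apply pow2_ge_0. }
assert (sum_k_pos : forall l, 0 <= sum_k (W_term beta f) l).
{ intros [|l]; unfold sum_k; simpl gam.
  - change (0 + 1)%nat with 1%nat; rewrite sum_n_n; apply term_pos.
  - rewrite sum_n_Sm, sum_n_n by lia; apply Rplus_le_le_0_compat; apply term_pos. }
assert (h : sum_lk (W_term beta f) M <= Series (sum_k (W_term beta f))).
{ apply (is_lim_seq_incr_compare (sum_n (sum_k (W_term beta f)))).
  - exact (Series_correct _ hW).
  - intro n; rewrite sum_Sn; unfold plus; simpl.
    generalize (sum_k_pos (S n)); lra. }
unfold W_norm; rewrite pow2_sqrt; auto.
apply Rle_trans with (2 := h).
clear h; induction M as [|M IH]; rewrite ?sum_lk_O, ?sum_lk_S; auto.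
generalize (term_pos (S M) 1%nat) (term_pos (S M) 2%nat); lra.
Qed.

(** Padding with zeros beyond degree 2 n - 1 makes V n f an instance of [trig]
    for every larger degree, so that it can be compared with U term by term. *)
Definition V_coef (n : nat) (f : R -> R) (l k : nat) : R :=
  if (l <=? 2 * n - 1)%nat then h n l * inner_L2 f (Y l k) else 0.

Lemma V_trig n M f t : (2 * n - 1 <= M)%nat -> V n f t = trig (V_coef n f) M t.
Proof.
intros hM; unfold V, trig.
rewrite (sum_lk_ext _ (fun l k => V_coef n f l k * Y l k t)).
- induction hM as [|M hM IH]; auto.
  assert (E : forall k, V_coef n f (S M) k = 0).
    { intro k; unfold V_coef.
      destruct (Nat.leb_spec (S M) (2 * n - 1)); [lia|reflexivity]. }
    rewrite sum_lk_S, <- IH, !E; ring.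
- intros l k [hl _]; unfold V_coef.
  destruct (Nat.leb_spec l (2 * n - 1)); [reflexivity|lia].
Qed.

Lemma h_bounds n l : (1 <= n)%nat -> (l <= 2 * n - 1)%nat -> 0 <= h n l <= 1.
Proof.
intros hn hl; unfold h; destruct (Nat.leb_spec l n) as [h | h]; [lra|].
assert (0 < INR n) by (apply lt_0_INR; lia).
assert (INR n < INR l) by (apply lt_INR; lia).
assert (INR l <= 2 * INR n)
  by (replace 2 with (INR 2) by reflexivity; rewrite <- mult_INR; apply le_INR; lia).
assert (E : 1 - (INR l - INR n) / INR n = (2 * INR n - INR l) / INR n) by (field; lra).
split.
- rewrite E; apply Rdiv_le_0_compat; lra.
- assert (0 <= (INR l - INR n) / INR n) by (apply Rdiv_le_0_compat; lra); lra.
Qed.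

Lemma V_coef_square_le n f l k : (1 <= n)%nat ->
  V_coef n f l k ^ 2 <= Rabs (inner_L2 f (Y l k)) ^ 2.
Proof.
intros hn; rewrite pow2_abs; unfold V_coef.
destruct (Nat.leb_spec l (2 * n - 1)) as [hl | _].
- destruct (h_bounds n l hn hl); rewrite Rpow_mult_distr.
  assert (0 <= inner_L2 f (Y l k) ^ 2) by apply pow2_ge_0.
  assert (h n l ^ 2 <= 1) by nra; nra.
- rewrite pow_i by lia; apply pow2_ge_0.
Qed.

(** With s = sqrt lambda * b the left-hand side is (s^2 / (1 + s^2))^2, and
    s / (1 + s^2) <= 1 / 2, which leaves s^2 / 4. *)
Lemma filter_error_le lambda b : 0 < lambda ->
  (/ (1 + lambda * b ^ 2) - 1) ^ 2 <= lambda / 4 * b ^ 2.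
Proof.
intros hl.
assert (hb : 0 <= b ^ 2) by apply pow2_ge_0.
set (q := lambda * b ^ 2); assert (hq : 0 <= q) by (unfold q; nra).
replace (lambda / 4 * b ^ 2) with (q / 4) by (unfold q; field).
replace ((/ (1 + q) - 1) ^ 2) with (q ^ 2 / (1 + q) ^ 2) by (field; lra).
apply Rle_div_l; [nra|].
assert (0 <= q * (1 - q) ^ 2) by (apply Rmult_le_pos; [lra|apply pow2_ge_0]); nra.
Qed.

Lemma filter_contracts lambda b c : 0 < lambda ->
  (c / (1 + lambda * b ^ 2)) ^ 2 <= c ^ 2.
Proof.
intros hl.
assert (hb : 0 <= b ^ 2) by apply pow2_ge_0.
assert (hq : 1 <= 1 + lambda * b ^ 2) by nra.
assert (h1 : 0 < / (1 + lambda * b ^ 2)) by (apply Rinv_0_lt_compat; lra).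
assert (h2 : / (1 + lambda * b ^ 2) <= 1)
  by (rewrite <- Rinv_1; apply Rinv_le_contravar; lra).
unfold Rdiv; rewrite Rpow_mult_distr.
assert (0 <= c ^ 2) by apply pow2_ge_0.
assert ((/ (1 + lambda * b ^ 2)) ^ 2 <= 1) by nra; nra.
Qed.

Definition U_coef (beta : nat -> nat -> R) (lambda : R) (N : nat) (x : nat -> R)
    (g : R -> R) (l k : nat) : R :=
  trapezoid N x (fun t => g t * Y l k t) / (1 + lambda * beta l k ^ 2).

Lemma U_trig beta lambda L N x g t :
  U beta lambda L N x g t = trig (U_coef beta lambda N x g) L t.
Proof. reflexivity. Qed.

Lemma norm_L2_triangle u v : cont u -> cont v ->
  norm_L2 (fun t => u t + v t) <= norm_L2 u + norm_L2 v.
Proof. exact (minkowski 0 _ (integral_quadrature 0) u v). Qed.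

Lemma norm_L2_le_sup u M : cont u -> 0 <= M -> (forall t, Rabs (u t) <= M) ->
  norm_L2 u <= sqrt (2 * PI) * M.
Proof.
intros hu hM h; assert (hpi := PI_RGT_0).
replace (sqrt (2 * PI) * M) with (sqrt (2 * PI * M ^ 2))
  by (rewrite sqrt_mult, sqrt_pow2; nra).
apply sqrt_le_1_alt.
exact (quad_square_le 0 _ (integral_quadrature 0) u M hu h).
Qed.

Lemma norm_L2_trig c M :
  norm_L2 (trig c M) = sqrt (sum_lk (fun l k => c l k ^ 2) M).
Proof.
unfold norm_L2; f_equal.
exact (parseval (2 * M) _ (integral_quadrature (2 * M)) c M (le_n _)).
Qed.

(** Parseval for the integral on the left, Bessel for the trapezoidal rule on
    the right. *)
Lemma norm_L2_U_le beta lambda L N x g M : (2 * L < N)%nat -> equidistant N x ->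
  0 < lambda -> cont g -> 0 <= M -> (forall t, Rabs (g t) <= M) ->
  norm_L2 (trig (U_coef beta lambda N x g) L) <= sqrt (2 * PI) * M.
Proof.
intros hN hx hl hg hM hgM; assert (hpi := PI_RGT_0).
assert (Q := trapezoid_quadrature (2 * L) N x hN hx).
rewrite norm_L2_trig.
replace (sqrt (2 * PI) * M) with (sqrt (2 * PI * M ^ 2))
  by (rewrite sqrt_mult, sqrt_pow2; nra).
apply sqrt_le_1_alt.
apply Rle_trans with (2 := quad_square_le _ _ Q g M hg hgM).
apply Rle_trans with (2 := bessel _ _ Q g L (le_n _) hg).
apply sum_lk_le; intros l k _; apply filter_contracts; auto.
Qed.

Lemma U_coef_trig beta lambda L N x c l k : (2 * L < N)%nat -> equidistant N x ->
  index L l k ->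
  U_coef beta lambda N x (trig c L) l k = c l k / (1 + lambda * beta l k ^ 2).
Proof.
intros hN hx hlk; unfold U_coef.
rewrite (trig_coef _ _ (trapezoid_quadrature (2 * L) N x hN hx)); auto.
Qed.

Lemma U_coef_minus beta lambda N x u v l k : (0 < N)%nat -> equidistant N x ->
  cont u -> cont v ->
  U_coef beta lambda N x u l k =
  U_coef beta lambda N x (fun t => u t - v t) l k + U_coef beta lambda N x v l k.
Proof.
intros hN hx hu hv; unfold U_coef.
rewrite (quad_plus _ _ (trapezoid_quadrature 0 N x hN hx)
  (fun t => (u t - v t) * Y l k t) (fun t => v t * Y l k t)
  (fun t => u t * Y l k t)); auto with circle.
- unfold Rdiv; ring.
- intro t; ring.
Qed.

Lemma C_const_ge_1 lambda beta L : 0 < lambda -> 1 <= C_const lambda beta L.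
Proof.
intros hl; unfold C_const; rewrite <- sqrt_1 at 1; apply sqrt_le_1_alt.
assert (zero : forall n m, sum_n_m (fun _ : nat => 0) n m = 0)
  by (intros; rewrite sum_n_m_const; apply Rmult_0_r).
assert (h : 0 <= sum_n_m (fun l => sum_n_m (fun k => 1 / beta l k ^ 4) 1 2) 1 L).
{ rewrite <- (zero 1%nat L); apply sum_n_m_le; intro l.
  rewrite <- (zero 1%nat 2%nat); apply sum_n_m_le; intro k.
  replace (1 / beta l k ^ 4) with ((/ beta l k ^ 2) ^ 2).
  - apply pow2_ge_0.
  - rewrite pow_inv, <- pow_mult; simpl Nat.mul; unfold Rdiv; ring. }
assert (0 < 1 / lambda ^ 2) by (apply Rdiv_lt_0_compat; nra).
nra.
Qed.

Theorem theorem4p1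
  (L N : nat) (lambda : R) (beta : nat -> nat -> R) (x : nat -> R)
  (f feps eps : R -> R)
  (hL : (2 <= L)%nat)
  (hN : (2 * L + 1 <= N)%nat)
  (hx : equidistant N x)
  (hlambda : 0 < lambda)
  (hbeta_nonneg : beta_nonneg beta)
  (hbeta_mono : beta_nondecreasing beta)
  (hbeta0 : beta 0%nat 1%nat = 0)
  (hbeta_pos : forall l k, (1 <= l)%nat -> (1 <= k <= 2)%nat -> 0 < beta l k)
  (hf : CS1 f) (hfeps : CS1 feps) (heps : CS1 eps)
  (hfW : in_W beta f)
  (hnoise : sup_norm (fun t => f t - feps t) = sup_norm eps)
  (hV : sup_norm (fun t => V (Nat.div L 2) f t - f t) <= sup_norm eps) :
  norm_L2 (fun t => U beta lambda L N x feps t - f t)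
    <= sqrt (2 * PI) * (2 * C_const lambda beta L + 1) * sup_norm eps
       + sqrt lambda / 2 * W_norm beta f.
Proof.
assert (hN' : (2 * L < N)%nat) by lia.
set (n := Nat.div L 2) in *.
assert (hn : (1 <= n)%nat) by (apply Nat.div_le_lower_bound; lia).
assert (hnL : (2 * n - 1 <= L)%nat)
  by (generalize (Nat.Div0.mul_div_le L 2); unfold n; lia).
set (c := V_coef n f); set (p := trig c L).
set (e := sup_norm eps) in *.
assert (e_pos : 0 <= e)
  by (apply Rle_trans with (1 := Rabs_pos (eps 0)), sup_norm_ge, heps).
assert (hpf : forall t, Rabs (p t - f t) <= e).
{ intro t; apply Rle_trans with (2 := hV).
  unfold p, c; rewrite <- V_trig by auto.
  apply (sup_norm_ge (fun t => V n f t - f t)).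
  destruct (CS1_minus _ _ (CS1_trig c L) hf) as [hc hp].
  split.
  - apply (cont_ext _ _ hc); intro s; unfold c; rewrite (V_trig n L); auto.
  - intro s; rewrite !(V_trig n L) by auto; apply hp. }
assert (hfn : forall t, Rabs (f t - feps t) <= e).
{ intro t; rewrite <- hnoise.
  apply (sup_norm_ge (fun t => f t - feps t)), CS1_minus; auto. }
assert (hd : forall t, Rabs (feps t - p t) <= 2 * e).
{ intro t; specialize (hpf t); specialize (hfn t).
  apply Rabs_le_between in hpf; apply Rabs_le_between in hfn.
  apply Rabs_le_between; lra. }
assert (cf : cont f) by exact (proj1 hf).
assert (cfe : cont feps) by exact (proj1 hfeps).
assert (cp : cont p) by apply cont_trig.
set (d := fun t => feps t - p t).
assert (cd : cont d) by (unfold d; auto with circle).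
(* The coefficients of U p - p. *)
set (r := fun l k => c l k * (/ (1 + lambda * beta l k ^ 2) - 1)).
set (noise := trig (U_coef beta lambda N x d) L).
assert (split_error : forall t,
  U beta lambda L N x feps t - f t = noise t + (trig r L t + (p t - f t))).
{ intro t; rewrite U_trig.
  enough (E : trig (U_coef beta lambda N x feps) L t = noise t + (trig r L t + p t))
    by (rewrite E; ring).
  unfold noise, p, trig; rewrite <- !sum_lk_plus.
  apply sum_lk_ext; intros l k hlk.
  rewrite (U_coef_minus _ _ _ _ feps p); auto; [|lia].
  unfold p; rewrite (U_coef_trig _ _ L); auto.
  fold p d; unfold r, Rdiv; ring. }
assert (bound_noise : norm_L2 noise <= sqrt (2 * PI) * (2 * e))
  by (apply norm_L2_U_le; auto; lra).
assert (W_pos : 0 <= W_norm beta f) by apply sqrt_pos.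
assert (bound_filter : norm_L2 (trig r L) <= sqrt lambda / 2 * W_norm beta f).
{ rewrite norm_L2_trig.
  assert (s_pos := sqrt_pos lambda).
  rewrite <- (sqrt_pow2 (sqrt lambda / 2 * W_norm beta f)) by nra.
  apply sqrt_le_1_alt.
  replace ((sqrt lambda / 2 * W_norm beta f) ^ 2)
    with (lambda / 4 * W_norm beta f ^ 2)
    by (transitivity (sqrt lambda ^ 2 / 4 * W_norm beta f ^ 2);
        [rewrite pow2_sqrt by lra; reflexivity | field]).
  apply Rle_trans with (lambda / 4 * sum_lk (W_term beta f) L).
  - rewrite <- sum_lk_scal; apply sum_lk_le; intros l k _.
    rewrite W_termE; unfold r; rewrite Rpow_mult_distr, Rmult_comm, <- Rmult_assoc.
    apply Rmult_le_compat; try apply pow2_ge_0.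
    + apply filter_error_le; auto.
    + apply V_coef_square_le; auto.
  - apply Rmult_le_compat_l; [lra|]; apply partial_sum_le_W_norm; auto. }
assert (bound_V : norm_L2 (fun t => p t - f t) <= sqrt (2 * PI) * e)
  by (apply norm_L2_le_sup; auto with circle).
assert (E : norm_L2 (fun t => U beta lambda L N x feps t - f t) =
            norm_L2 (fun t => noise t + (trig r L t + (p t - f t)))).
{ unfold norm_L2, inner_L2; f_equal; apply RInt_ext; intros t _.
  rewrite split_error; reflexivity. }
rewrite E.
assert (T1 := norm_L2_triangle noise (fun t => trig r L t + (p t - f t))).
assert (T2 := norm_L2_triangle (trig r L) (fun t => p t - f t)).
specialize (T1 (cont_trig _ _)); specialize (T2 (cont_trig _ _)).
lapply T1; [clear T1; intro T1 | auto with circle].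
lapply T2; [clear T2; intro T2 | auto with circle].
assert (hC := C_const_ge_1 lambda beta L hlambda).
assert (0 <= sqrt (2 * PI) * e) by (apply Rmult_le_pos; [apply sqrt_pos|auto]).
nra.
Qed.
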